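(* Let $k\geq 1$ be an integer, let $G$ be a graph, and let the vertex set $V(G)$ be partitioned into two sets $A$ and $B$. (A) If $$2e_G(A)+e_G(A,B)>(2k-2)|A|+k|B|,$$ then $G$ contains a path of order $2k$ or $2k+1$ with both ends in $A$. (B) If $$2e_G(A)+e_G(A,B)>(2k-1)|A|+k|B|,$$ then $G$ contains a path of order $2k+1$ with both ends in $A$.
   Context: Graphs are finite, simple and undirected. For a set $X\subseteq V(G)$, $e_G(X)$ denotes the number of edges of $G$ induced by $X$ (both endpoints in $X$). For disjoint $X,Y\subseteq V(G)$, $e_G(X,Y)$ denotes the number of edges of $G$ joining a vertex of $X$ to a vertex of $Y$. The order of a path is its number of vertices; paths have no repeated vertices and need not be induced. The set $A$ or the set $B$ of the partition may be empty. *)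

(* Defs.v *)
(* MathComp world. *)
From mathcomp Require Import all_boot.

Set Implicit Arguments.
Unset Strict Implicit.
Unset Printing Implicit Defensive.

(* A finite simple graph is given by a finite vertex type [V] and a symmetric
   irreflexive adjacency relation [e]; its edges are unordered pairs, so each
   one is counted once. *)
Definition edges (V : finType) (e : rel V) : {set {set V}} :=
  [set E : {set V} | [exists x, exists y, e x y && (E == [set x; y])]].

Definition edges_in (V : finType) (e : rel V) (X : {set V}) : nat :=
  #|[set E in edges e | E \subset X]|.

Definition edges_between (V : finType) (e : rel V) (X Y : {set V}) : nat :=
  #|[set E in edges e | [exists x in X, exists y in Y, E == [set x; y]]]|.

(* The vertex sequence of the path is [x :: p], with ends [x] and [last x p];
   its order is its number of vertices. *)
Definition has_path_with_ends_in
    (V : finType) (e : rel V) (X : {set V}) (n : nat) : Prop :=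
  exists (x : V) (p : seq V),
    [/\ path e x p, uniq (x :: p), size (x :: p) = n,
        x \in X & last x p \in X].

(* Main.v *)
Require Import Defs.
From mathcomp Require Import all_boot.
From mathcomp Require Import zify.

Set Implicit Arguments.
Unset Strict Implicit.
Unset Printing Implicit Defensive.

(** Delete the edges inside [B], so that [B] is independent, and call a path with
    both ends in [A] an A-path.  The left-hand side of both
    hypotheses is the sum of the degrees of the vertices of [A], and with
    [t = 2k - 2] or [t = 2k - 1] the hypothesis says that this sum exceeds
    [t |A| + k |B|].  Among the vertex sets on which such an excess holds take a
    minimal one.  Deleting any part of it destroys the excess, so the part
    contributes more than its share ([minset_dense_critical]): a vertex of [A] has
    weighted degree above [t], where a neighbour counts 2 if it is in [A] and 1
    otherwise; a non-isolated vertex of [B] has degree above [k]; a union of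
    components that meets [A] has more than [t + 1] vertices.

    Let [P] be a longest A-path of such a critical graph, with [m] vertices.

    Suppose [m <= t + 1 <= 2k].  Since [B] is independent, fewer than [k] vertices
    of [P] are in [B].  A neighbour outside [P] of an end of [P] would be a vertex
    [b] of [B] with all its more than [k] neighbours on [P]; rerouting through [b]
    shows that each of them, the end itself apart, is preceded on [P] by a vertex
    of [B], which is too many.  So both ends have all their neighbours on [P], the
    weighted degrees give the usual crossing pair of chords, and [P] closes up into
    a cycle.  Rotating this cycle, the same kind of count shows that no edge leaves
    it; it is then a union of components with at most [t + 1] vertices, which is
    impossible ([longest_apath_long]).  Hence [m >= t + 2].

    For (A), the initial segment of [P] with [2k] vertices, or the one with
    [2k + 1], ends in [A].

    For (B), suppose that [m >= 2k + 2] and that no A-path has exactly [2k + 1]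
    vertices.  Then two positions of [P] at distance [2k] are never both in [A].
    This forces [m = 2k + 2j], with membership in [A] alternating on the first [2j]
    and on the last [2j] positions.  Every chord from the first vertex of [P], and
    every detour from it through an outside vertex, produces A-paths with [2k + 1]
    vertices unless certain positions behind the point where it returns to [P],
    every second one and at most [j + 1] of them, are all in [B].  Somewhere in the middle two consecutive vertices
    are in [A], and they exclude a whole block of about [2j] return points.
    Counting the rest two by two leaves at most [k] return points for a detour
    ([few_detours]) and weighted degree below [2k] for the first vertex
    ([light_chords]), against criticality. *)

(** * Paths with both ends in a given set *)

(** [lia] case-splits on every boolean hypothesis, membership and uniqueness
    included, so only order and parity facts are left in the context. *)
Ltac lia_nat :=
  repeat match goal with
  | H : is_true ?b |- _ =>
      lazymatch b with leq _ _ => fail | odd _ => fail | _ => clear H end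
  end; lia.

Lemma ex_longest (T : finType) (P : pred (seq T)) (s0 : seq T) :
  (forall s, P s -> uniq s) -> P s0 ->
  exists2 s, P s & forall s', P s' -> size s' <= size s.
Proof.
move=> Puniq Ps0; pose Q n := [exists s : n.-tuple T, P s].
have QP s : P s -> Q (size s) by move=> Ps; apply/existsP; exists (in_tuple s).
have Qmax n : Q n -> n <= #|T|.
  case/existsP=> s /Puniq s_uniq.
  by rewrite -(size_tuple s) -(card_uniqP s_uniq) max_card.
have exQ : exists n, Q n by exists (size s0); exact: QP.
case: (ex_maxnP exQ Qmax) => n /existsP[s Ps] max_n.
by exists s => // s' /QP /max_n; rewrite size_tuple.
Qed.

Section APaths.

Variables (V : finType) (g : rel V) (A : {set V}).
Hypotheses (g_sym : symmetric g) (g_irr : irreflexive g).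
Hypothesis g_A : forall x y, g x y -> (x \in A) || (y \in A).

Definition apath (s : seq V) : bool :=
  if s is x :: p then [&& path g x p, uniq s, x \in A & last x p \in A]
  else false.

Definition longest (s : seq V) := forall s', apath s' -> size s' <= size s.

Lemma apath_uniq s : apath s -> uniq s.
Proof. by case: s => // x p /and4P[]. Qed.

Lemma path_catrev x s t : path g x s -> path g x t -> sorted g (catrev s (x :: t)).
Proof.
elim: s x t => [|y s IHs] x t //= /andP[gxy ys] xt.
by apply: IHs => //=; rewrite g_sym gxy.
Qed.

(** The pattern behind reversals, chords and detours: two paths issuing from [x],
    joined there after reversing one of them. *)
Lemma apath_join x s t :
  path g x s -> path g x t -> uniq (x :: s ++ t) ->
  last x s \in A -> last x t \in A -> apath (catrev s (x :: t)).
Proof.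
move=> xs xt uniq_st sA tA.
have uniq_cr : uniq (catrev s (x :: t)).
  rewrite catrevE (perm_uniq (_ : perm_eq _ (x :: s ++ t))) //.
  by rewrite perm_catC /= perm_cons perm_catC perm_cat2r perm_rev.
have := path_catrev xs xt; move: uniq_cr.
case/lastP: s {xs uniq_st} sA => [|s z]; first by rewrite /= => -> -> ->.
rewrite last_rcons catrevE rev_rcons /= last_cat /= tA.
by move=> -> -> ->.
Qed.

Lemma apath_rev s : apath s -> apath (rev s).
Proof.
case: s => // x p /and4P[xp up xA lA].
rewrite /rev -[catrev _ _]/(catrev p [:: x]).
by apply: apath_join; rewrite ?cats0.
Qed.

Lemma apath_cons z x p :
  apath (x :: p) -> g x z -> z \in A -> z \notin x :: p -> apath (z :: x :: p).
Proof.
move=> /and4P[xp up xA lA] gxz zA zp.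
apply/and4P; split=> //=; first by rewrite g_sym gxz.
by rewrite zp.
Qed.

(** The reroutings used with a longest path [x :: p]: follow it backwards from
    position [l] to [x], cross [M] (empty for a chord, one outside vertex for a
    detour), and come back at position [i] to go forward up to position [j]. *)
Lemma apath_splice x p M l i j :
  path g x p -> uniq (x :: p) -> l < i -> i <= j -> j <= size p ->
  path g x (rcons M (nth x p i.-1)) -> uniq M -> {in M, forall z, z \notin x :: p} ->
  nth x (x :: p) l \in A -> nth x (x :: p) j \in A ->
  exists2 s, apath s & size s = l.+1 + size M + (j - i).+1.
Proof.
case: i => // i xp up li ij jp; rewrite [_.-1]/= => xM uM Mp lA jA.
have li' : l <= i by [].
have ip : i < size p by lia_nat.
pose t := take (j - i.+1).+1 (drop i p).
have tE : t = nth x p i :: take (j - i.+1) (drop i.+1 p).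
  by rewrite /t (drop_nth x).
have lastl : last x (take l p) = nth x (x :: p) l.
  rewrite (last_nth x) size_take.
  rewrite (_ : (if _ then _ else _) = l); last by case: ifP; lia_nat.
  by case: l {li lA} li' => //= l li; rewrite nth_take.
have sz : size t = (j - i.+1).+1.
  by rewrite size_takel // size_drop; lia_nat.
have lastt : last x (M ++ t) = nth x (x :: p) j.
  rewrite last_cat tE /= (last_nth x) -tE.
  have -> : size (take (j - i.+1) (drop i.+1 p)) = j - i.+1.
    by rewrite size_takel // size_drop; lia_nat.
  rewrite /t nth_take // nth_drop.
  by case: j ij {jp jA sz tE t} => //= j ij; congr nth; lia_nat.
exists (catrev (take l p) (x :: M ++ t)); last first.
  by rewrite catrevE size_cat size_rev /= size_cat sz size_takel; lia_nat.
have up0 : uniq (x :: take i p ++ drop i p) by rewrite cat_take_drop.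
have sub_t : {subset t <= drop i p} by move=> z /mem_take.
have sub_l : {subset take l p <= take i p}.
  by move=> z; rewrite -(subnKC li') takeD mem_cat => ->.
apply: apath_join; rewrite ?lastl ?lastt //; first exact: take_path.
- rewrite tE -cat_rcons cat_path xM /= last_rcons.
  apply: take_path.
  have : path g x (take i p ++ drop i p) by rewrite cat_take_drop.
  by rewrite cat_path (drop_nth x) //= => /and3P[].
- have xM' : x \notin M by apply/negP => /Mp; rewrite mem_head.
  move: up0; rewrite /= !mem_cat !negb_or !cat_uniq => /andP[/andP[x1 x2]].
  case/and3P=> u1 /hasPn u12 u2.
  rewrite xM' (contra (@sub_l x) x1) (contra (@sub_t x) x2) /= uM.
  have [_ up'] := andP up; rewrite take_uniq //= /t take_uniq // andbT.
  apply/andP; split.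
    apply/hasPn=> z; rewrite mem_cat => /orP[/Mp|/sub_t/u12]; last exact/contra/sub_l.
    by rewrite inE negb_or => /andP[_]; apply: contra => /mem_take.
  apply/hasPn=> z /sub_t zt; apply/negP=> /Mp; rewrite inE negb_or.
  by rewrite (mem_drop zt) andbF.
Qed.

(** Otherwise prepending [z], or [z] and then [y], would lengthen the path. *)
Lemma head_off x p z :
  longest (x :: p) -> apath (x :: p) -> g x z -> z \notin x :: p ->
  z \notin A /\ forall y, g z y -> y \in x :: p.
Proof.
move=> maxp xp gxz zp; have zA : z \notin A.
  apply/negP=> zA; have := maxp _ (apath_cons xp gxz zA zp).
  by rewrite /= ltnn.
split=> // y gzy; apply/negPn/negP=> yp.
have yA : y \in A by have := g_A gzy; rewrite (negPf zA).
have yz : y != z by apply: contraL gzy => /eqP ->; rewrite g_irr.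
case/and4P: (xp) => px up xA lA.
suff /maxp: apath (y :: z :: x :: p) by rewrite /= ltnNge leqnSn.
apply/and4P; split=> //=; first by rewrite g_sym gzy g_sym gxz.
by move: yp zp up; rewrite /= !inE !negb_or yz => -> ->.
Qed.

Lemma sum_nbrs z x p (f : V -> nat) :
  uniq (x :: p) -> (forall y, g z y -> y \in x :: p) ->
  \sum_(y | g z y) f y =
  \sum_(0 <= i < (size p).+1) g z (nth x (x :: p) i) * f (nth x (x :: p) i).
Proof.
move=> up sub; rewrite -[(size p).+1]/(size (x :: p)).
rewrite -(big_nth x predT (fun y => g z y * f y)) big_mkcond.
rewrite (bigID (mem (x :: p))) /= [X in _ + X]big1 ?addn0; last first.
  by move=> y /(contra (@sub y)) /negPf ->.
rewrite [RHS]big_uniq //; apply: eq_bigr => y _.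
by case: (g z y); rewrite ?mul1n ?mul0n.
Qed.

(** The vertices outside [A] are independent and none of them is the last one, so
    each is followed by a vertex of [A]; the second summand makes the induction
    go through. *)
Lemma count_nonA x p :
  path g x p -> last x p \in A ->
  2 * count (predC (mem A)) (x :: p) + (x \in A) <= (size p).+1.
Proof.
elim: p x => [|y p IHp] x; first by move=> _ /= ->.
rewrite [path _ _ _]/= [last _ _]/= => /andP[gxy yp] lA.
have := IHp y yp lA; have := g_A gxy; rewrite /=.
by case: (x \in A) => /=; case: (y \in A) => //=; lia_nat.
Qed.

Lemma apath_sub x p i j :
  path g x p -> uniq (x :: p) -> i <= j -> j <= size p ->
  nth x (x :: p) i \in A -> nth x (x :: p) j \in A ->
  exists2 s, apath s & size s = (j - i).+1.
Proof.
move=> xp up ij jp iA jA.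
pose v := nth x (x :: p) i; pose q := take (j - i) (drop i p).
have szq : size q = j - i by rewrite size_takel // size_drop; lia_nat.
exists (v :: q); last by rewrite /= szq.
have vq : v :: q = take (j - i).+1 (drop i (x :: p)).
  by rewrite (drop_nth x) //= ltnS; exact: leq_trans ij jp.
apply/and4P; split=> //.
- have : sorted g (v :: q) by rewrite vq take_sorted // drop_sorted.
  by [].
- by rewrite vq take_uniq // drop_uniq.
- by rewrite (last_nth x) vq szq nth_take // nth_drop subnKC.
Qed.

Lemma nth_adj x p i :
  path g x p -> i.+1 < (size p).+1 ->
  (nth x (x :: p) i \in A) || (nth x (x :: p) i.+1 \in A).
Proof. by move=> /(pathP x) xp /xp/g_A. Qed.

(** If the vertex at position [n - 1] is not in [A], then the next one is. *)
Lemma apath_trunc x p n :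
  path g x p -> uniq (x :: p) -> x \in A -> last x p \in A -> 0 < n <= (size p).+1 ->
  exists2 s, apath s & (size s = n \/ size s = n.+1).
Proof.
move=> px up xA lA /andP[n_gt0 np].
have [nA|nA] := boolP (nth x (x :: p) n.-1 \in A).
  have [|s sP szs] := apath_sub px up (leq0n n.-1) _ xA nA; first by lia_nat.
  by exists s => //; left; lia_nat.
have np' : n <= size p.
  rewrite leqNgt; apply: contra nA => pn; have -> : n.-1 = size p by lia_nat.
  by rewrite -last_nth.
have nA' : nth x (x :: p) n \in A.
  have := @nth_adj x p n.-1 px; rewrite (negPf nA) prednK //; exact.
have [s sP szs] := apath_sub px up (leq0n n) np' xA nA'.
by exists s => //; right; lia_nat.
Qed.

End APaths.

(** * Critical graphs, and longest paths that are too short *)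

(** The local information that holds in a minimal dense subgraph.  In
    [crit_A] a neighbour in [A] counts twice because deleting [a] removes it from
    the degree sum over [A] both at [a] and at that neighbour. *)
Record critical (V : finType) (g : rel V) (A : {set V}) (k t : nat) : Prop := Critical {
  crit_sym : symmetric g;
  crit_irr : irreflexive g;
  crit_edge : forall x y, g x y -> (x \in A) || (y \in A);
  crit_A : forall a, a \in A -> t < \sum_(y | g a y) (y \in A).+1;
  crit_B : forall b y, b \notin A -> g b y -> k < \sum_(y | g b y) 1;
  crit_closed : forall (X : {set V}) a,
    (forall x y, x \in X -> g x y -> y \in X) -> a \in X -> a \in A -> t.+1 < #|X| }.

Section Critical.

Variables (V : finType) (g : rel V) (A : {set V}) (k t : nat).
Hypothesis crit : critical g A k t.

Local Notation g_sym := (crit_sym crit).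
Local Notation g_irr := (crit_irr crit).
Local Notation g_A := (crit_edge crit).

(** A neighbour [z] of [x] outside the path is not in [A] and has all its more than
    [k] neighbours on the path; a detour through [z] shows that each of them except
    [x] comes right after a vertex outside [A], and there are fewer than [k] of
    those. *)
Lemma short_head_saturated x p z :
  longest g A (x :: p) -> apath g A (x :: p) -> size p < 2 * k ->
  g x z -> z \in x :: p.
Proof.
move=> maxp xp szp gxz; apply/negPn/negP=> zp.
have [zA zN] := head_off g_sym g_irr g_A maxp xp gxz zp.
case/and4P: (xp) => px up xA lA.
pose v i := nth x (x :: p) i.
have := crit_B crit zA (_ : g z x); rewrite g_sym => /(_ gxz).
have := count_nonA g_A px lA; rewrite xA.
rewrite -sum1_count (big_nth x) -[size (x :: p)]/(size p).+1 big_mkcond.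
rewrite big_nat_recr // [X in 2 * (_ + X)]/= -last_nth lA addn0.
rewrite (sum_nbrs _ up zN) big_nat_recl //.
suff : \sum_(0 <= i < size p) g z (v i.+1) * 1 <=
       \sum_(0 <= i < size p) (if v i \notin A then 1 else 0).
  by rewrite /v /=; case: (g z x) => /=; lia_nat.
rewrite !big_nat; apply: leq_sum => i /andP[_ ip].
rewrite muln1; case: ifP => [|/negbFE iA]; first by case: (g _ _).
case gzi : (g z _) => //.
have [||||||||s sA sz] := @apath_splice _ _ A g_sym x p [:: z] i i.+1 (size p) px up => //.
- by rewrite /= gxz gzi.
- by move=> y; rewrite inE => /eqP ->.
- by rewrite -last_nth.
by have := maxp s sA; rewrite sz /=; lia_nat.
Qed.

(** Ore's crossing argument with weights: if no [i] had both [x] adjacent to position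
    [i + 1] and the last vertex adjacent to position [i], then each of the at most [t]
    values of [i] would contribute at most 2 to the sum of the two weighted degrees,
    which is at least [2 (t + 1)]. *)
Lemma short_cycle x p :
  path g x p -> uniq (x :: p) -> x \in A -> last x p \in A -> size p <= t ->
  (forall z, g x z -> z \in x :: p) -> (forall z, g (last x p) z -> z \in x :: p) ->
  exists c, [/\ cycle g c, uniq c & perm_eq c (x :: p)].
Proof.
move=> xp up xA lA szp xN lN.
pose v i := nth x (x :: p) i.
have [i ip /andP[gxi gli]] : exists2 i, i < size p & g x (v i.+1) && g (last x p) (v i).
  case: (pickP [pred i : 'I_(size p) | g x (v i.+1) && g (last x p) (v i)]) => [i|none].
    by exists i.
  have wx : \sum_(y | g x y) (y \in A).+1 =
            \sum_(0 <= i < size p) g x (v i.+1) * (v i.+1 \in A).+1.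
    by rewrite (sum_nbrs _ up xN) big_nat_recl // g_irr.
  have wl : \sum_(y | g (last x p) y) (y \in A).+1 =
            \sum_(0 <= i < size p) g (last x p) (v i) * (v i \in A).+1.
    rewrite (sum_nbrs _ up lN) big_nat_recr // -last_nth g_irr; exact: addn0.
  have : \sum_(0 <= i < size p) (g x (v i.+1) * (v i.+1 \in A).+1 +
           g (last x p) (v i) * (v i \in A).+1) <= \sum_(0 <= i < size p) 2.
    rewrite !big_nat; apply: leq_sum => i /andP[_ ip].
    have /= := none (Ordinal ip).
    by case: (g x _); case: (g (last _ _) _) => //=; do 2! case: (_ \in A).
  rewrite big_split /= -wx -wl sum_nat_const_nat.
  by have := crit_A crit xA; have := crit_A crit lA; lia_nat.
pose s1 := take i p; pose s2 := drop i p.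
have ps : p = s1 ++ s2 by rewrite cat_take_drop.
have s2E : s2 = v i.+1 :: drop i.+1 p by rewrite /s2 (drop_nth x).
have last1 : last x s1 = v i.
  rewrite (last_nth x) size_takel 1?ltnW // /s1 /v.
  by case: (i) ip => //= n np; rewrite nth_take.
have last2 : last (v i.+1) (drop i.+1 p) = last x p.
  by rewrite [in RHS]ps last_cat s2E.
exists (x :: s1 ++ rev s2); split.
- rewrite /= -cats1 -catA cat_path.
  move: xp; rewrite {1}ps cat_path => /andP[-> /=].
  rewrite last1 s2E /= => /andP[_ sp].
  rewrite lastI rev_rcons last2 /= g_sym gli /=.
  rewrite cats1 -rev_cons -last2 -[last _ _]/(last x (v i.+1 :: drop i.+1 p)).
  rewrite -[_ :: belast _ _]/(belast x (v i.+1 :: drop i.+1 p)) rev_path /=.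
  by rewrite g_sym gxi (eq_path (e' := g)) // => a b; rewrite g_sym.
- move: up; rewrite ps /= !mem_cat mem_rev => /andP[-> /=].
  rewrite !cat_uniq rev_uniq => /and3P[-> + ->]; rewrite andbT /=.
  by apply: contra => /hasP[z zs zt]; apply/hasP; exists z; rewrite // -mem_rev.
- by rewrite perm_cons ps perm_cat2l perm_rev.
Qed.

(** If not, the path closes up into a cycle [c] on the same vertices; the rest of the
    proof shows that no edge leaves [c], against [crit_closed]. *)
Lemma longest_apath_long x p :
  longest g A (x :: p) -> apath g A (x :: p) -> t.+1 <= 2 * k -> 2 * k <= t.+2 ->
  t.+1 < size (x :: p).
Proof.
move=> maxp xp tk kt; rewrite ltnNge; apply/negP=> szp.
have szp2 : size p < 2 * k by exact: leq_trans szp tk.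
have sat y q : apath g A (y :: q) -> size q = size p ->
    (forall z, g y z -> z \in y :: q) /\ (forall z, g (last y q) z -> z \in y :: q).
  move=> yq szq.
  have maxq : longest g A (y :: q) by move=> s /maxp; rewrite /= szq.
  split=> z; first by apply: short_head_saturated; rewrite ?szq.
  rewrite -[z \in _]mem_rev lastI rev_rcons; apply: short_head_saturated.
  - by rewrite -rev_rcons -lastI => s /maxq; rewrite size_rev.
  - by rewrite -rev_rcons -lastI (apath_rev g_sym).
  - by rewrite size_rev size_belast szq.
have /sat-/(_ erefl)[xN lN] := xp.
have /and4P[px up xA lA] := xp.
have [c [cc uc pc]] := short_cycle px up xA lA szp xN lN.
have szc : size c = (size p).+1 by rewrite (perm_size pc).
have rotP u : u \in c -> exists i s, [/\ rot i c = u :: s, cycle g (u :: s),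
    uniq (u :: s), size s = size p & forall z, (z \in u :: s) = (z \in c)].
  case/rot_to=> i s def_s; exists i, s; rewrite -def_s rot_cycle rot_uniq.
  split=> // [|z]; last by rewrite mem_rot.
  by have := congr1 size def_s; rewrite size_rot szc => -[].
(* Cut at the edge from [u] to its successor, the cycle is a longest A-path ending
   at [u]. *)
have nextA u z : u \in A -> u \in c -> next c u \in A -> g u z -> z \in c.
  move=> uA /rotP[i [s [def_s cs us szs <-]]].
  rewrite -(next_rot i uc) def_s.
  case: s cs us szs {def_s} => [|y q]; first by rewrite /= g_irr.
  rewrite /= eqxx -cons_uniq => /andP[_ yq] /andP[uyq uq] szq yA guz.
  have yqP : apath g A (y :: rcons q u).
    apply/and4P; split; rewrite ?last_rcons //.
    by rewrite -rcons_cons rcons_uniq uyq.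
  have [|_] := sat _ _ yqP; first by rewrite size_rcons.
  by rewrite last_rcons => /(_ z guz); rewrite inE mem_rcons !inE orbCA.
(* Both cycle neighbours of [u] are in [A], and so is [z]: start at [z] and go
   once around. *)
have nonA u z : u \notin A -> u \in c -> g u z -> z \in c.
  move=> uA /rotP[i [s [_ cs us szs sc]]] guz; apply/negPn/negP=> zc.
  move: cs; rewrite /= rcons_path => /andP[ps gl].
  have lsA : last u s \in A by have := g_A gl; rewrite (negPf uA) orbF.
  have zA : z \in A by have := g_A guz; rewrite (negPf uA).
  suff /maxp : apath g A (z :: u :: s) by rewrite /= szs ltnn.
  apply/and4P; split=> //; first by rewrite /= g_sym guz.
  by rewrite cons_uniq sc zc.
have closed_c u z : u \in c -> g u z -> z \in c.
  move=> uc' guz; apply/negPn/negP=> zc.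
  have uA : u \in A by apply/negPn/negP=> uA; rewrite (nonA u z) in zc.
  have /rotP[i [s [_ cs us szs sc]]] := uc'.
  case/lastP: s cs us szs sc => [|s l]; first by rewrite /= g_irr.
  rewrite [cycle _ _]/= !rcons_path last_rcons size_rcons => /andP[/andP[ps gsl] glu] us szs sc.
  (* Otherwise the cycle cut before [u] is a longest A-path with [u] as an end. *)
  have lA' : l \notin A.
    apply/negP=> lA'; have usP : apath g A (u :: rcons s l).
      by apply/and4P; split=> //; rewrite ?last_rcons // rcons_path ps.
    have [|/(_ z guz)] := sat _ _ usP; first by rewrite size_rcons.
    by rewrite sc (negPf zc).
  have sA : last u s \in A by have := g_A gsl; rewrite (negPf lA') orbF.
  have us' : uniq (u :: s).
    by move: us; rewrite -rcons_cons rcons_uniq => /andP[_].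
  have sub_s y : y \in u :: s -> y \in c.
    by rewrite -sc -rcons_cons mem_rcons [_ \in _ :: _ :: _]inE => ->; rewrite orbT.
  have zs : z \notin u :: s by apply: contra zc => /sub_s.
  (* With [z] prepended and [l] dropped the length is unchanged: if [z] is in [A]
     this is again a longest A-path, otherwise it could be prolonged beyond [z]. *)
  have zN y : g z y -> y \in c.
    move=> gzy; have yz : y != z by apply: contraL gzy => /eqP ->; rewrite g_irr.
    have [zA|zA] := boolP (z \in A).
      have zsP : apath g A (z :: u :: s).
        apply/and4P; split=> //; first by rewrite /= g_sym guz.
        by rewrite cons_uniq zs.
      have [|/(_ y gzy)] := sat _ _ zsP; first by rewrite /= szs.
      by rewrite inE (negPf yz) => /sub_s.
    have yA : y \in A by have := g_A gzy; rewrite (negPf zA).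
    apply/negPn/negP=> yc.
    suff /maxp : apath g A (y :: z :: u :: s) by rewrite /= szs ltnn.
    apply/and4P; split=> //; first by rewrite /= g_sym gzy g_sym guz.
    by rewrite !cons_uniq -cons_uniq us' zs inE negb_or yz (contra (@sub_s y)).
  have zNA y : g z y -> y \in A.
    move=> gzy; apply/negPn/negP=> yA.
    by rewrite (nonA y z) // ?zN // g_sym in zc.
  have zNB y : g z y -> next c y \notin A.
    move=> gzy; apply/negP=> yA.
    by rewrite (nextA y z) // ?zN ?zNA // g_sym in zc.
  (* So the neighbours of [z] are in [A] with successors outside [A]; there are at
     least [k] of them, but [c] has fewer than [k] vertices outside [A]. *)
  have k_le : k <= \sum_(y | g z y) 1.
    have [zA|zA] := boolP (z \in A); last first.
      by rewrite ltnW // (crit_B crit zA (_ : g z u)) // g_sym.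
    have e2 : \sum_(y | g z y) (y \in A).+1 = 2 * \sum_(y | g z y) 1.
      by rewrite big_distrr; apply: eq_bigr => y /zNA ->.
    by have := crit_A crit zA; rewrite e2; lia_nat.
  have : \sum_(y | g z y) 1 <= count (predC (mem A)) c.
    rewrite sum1dep_card -(card_imset _ (can_inj (prev_next uc))).
    rewrite -size_filter -(card_uniqP (filter_uniq _ uc)).
    apply/subset_leq_card/subsetP=> _ /imsetP[y yz ->].
    by rewrite inE in yz; rewrite mem_filter mem_next zN //= zNB.
  have /permP-> := pc.
  have := count_nonA g_A px lA; rewrite xA; move: (count _ (x :: p)) => n.
  by lia_nat.
have xc : x \in c by rewrite (perm_mem pc) mem_head.
have := @crit_closed _ _ _ _ _ crit [set y in c] x _ _ xA; rewrite inE => h.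
have {h} := h _ xc; rewrite cardsE (card_uniqP uc) szc => h.
have {h} : t.+1 < (size p).+1 by apply: h => u z; rewrite !inE; exact: closed_c.
by rewrite /= in szp; lia_nat.
Qed.

End Critical.

(** * Counting positions along a long path *)

Lemma sum_pairs (F h : nat -> nat) n :
  (forall q, q < n -> F (2 * q) + F (2 * q).+1 <= h q) ->
  \sum_(0 <= i < 2 * n) F i <= \sum_(0 <= q < n) h q.
Proof.
elim: n => [|n IHn] Fh; first by rewrite muln0 !big_nil.
rewrite mulnS !big_nat_recr //= -addnA leq_add ?Fh //.
by apply: IHn => q qn; apply: Fh; exact: ltnW.
Qed.

Lemma sum_outside r j n :
  \sum_(0 <= q < n) ((q <= r) || (r + j < q)) = minn n r.+1 + (n - (r + j).+1).
Proof.
elim: n => [|n IHn]; first by rewrite big_nil min0n.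
by rewrite big_nat_recr //= IHn; case: leqP => ?; case: leqP => ? /=; lia.
Qed.

(** Here and below [a i] stands for membership in [A] of the vertex at position [i],
    counted from 0.  The two patterns propagate together: a position outside [A] is
    followed by one in [A], and a position in [A] forces the one at distance [2k] to
    be outside [A]. *)
Lemma alternating_ends (a : nat -> bool) k m :
  2 * k + 2 <= m -> a 0 -> a m.-1 ->
  (forall i, i.+1 < m -> a i || a i.+1) ->
  (forall i, i + 2 * k < m -> ~~ (a i && a (i + 2 * k))) ->
  exists j, [/\ 0 < j, m = 2 * (k + j) &
    forall i, i < 2 * j -> a i = ~~ odd i /\ a (2 * k + i) = odd i].
Proof.
move=> km a0 am adj no2k.
have alt i : 2 * k + i < m -> a i = ~~ odd i /\ a (2 * k + i) = odd i.
  elim: i => [|i IHi] im.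
    by have := no2k 0; rewrite a0 add0n addn0 /= => /(_ _)/negPf->; lia.
  have [ai aki] : a i = ~~ odd i /\ a (2 * k + i) = odd i by apply: IHi; lia.
  have := no2k i.+1; have := adj i; have := adj (2 * k + i).
  rewrite ai aki addSn [i + _]addnC -addnS /=.
  by case: (odd i) => /=; case: (a i.+1); case: (a (_ + _)); lia.
have oddm : odd (m.-1 - 2 * k).
  by have [|_ <-] := alt (m.-1 - 2 * k); last rewrite subnKC //; lia.
exists (m - 2 * k)./2; split; try lia.
by move=> i im; apply: alt; lia.
Qed.

Section PositionCounting.

Variables (a : nat -> bool) (k j : nat).
Hypotheses (k_gt0 : 0 < k) (j_gt0 : 0 < j).
Hypothesis a_adj : forall i, i.+1 < 2 * (k + j) -> a i || a i.+1.
Hypothesis a_ends :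
  forall i, i < 2 * j -> a i = ~~ odd i /\ a (2 * k + i) = odd i.

(** Position [2k - 1] is in [A], so the alternation starting at 0 breaks before it;
    it breaks first with two consecutive members of [A], at positions [2r] and
    [2r + 1]. *)
Lemma first_double :
  exists r, [/\ 0 < r, r < k, a (2 * r).+1 & forall i, i <= 2 * r -> a i = ~~ odd i].
Proof.
pose P i := [&& i.+1 < 2 * k, a i & a i.+1].
have a2k : a (2 * k) = false by have [|_] := a_ends (i := 0); rewrite ?addn0 //; lia.
have a2k1 : a (2 * k).-1.
  by have := a_adj (i := (2 * k).-1); rewrite prednK ?a2k ?orbF; lia.
have alt n : n < 2 * k -> (forall i, i < n -> ~~ P i) -> forall i, i <= n -> a i = ~~ odd i.
  move=> n2k none; elim=> [|i IHi] iln; first by case: (a_ends (i := 0)); lia.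
  have := none i iln; have := a_adj (i := i); rewrite /P IHi //=; last lia.
  by case: (odd i) => /=; case: (a i.+1); lia.
have exP : exists i, P i.
  case: (pickP (fun i : 'I_(2 * k) => P i)) => [i Pi|none]; first by exists i.
  have k2 : (2 * k).-1 < 2 * k by lia.
  have noP i : i < (2 * k).-1 -> ~~ P i.
    by move=> ik; have := none (Ordinal (ltn_trans ik k2)) => /= ->.
  by have := alt _ k2 noP _ (leqnn _); rewrite a2k1; lia.
case: (ex_minnP exP) => p /and3P[pk ap ap1] min_p.
have altp := alt p (ltnW pk) _.
have {}altp i : i <= p -> a i = ~~ odd i.
  by apply: altp => n np; apply/negP => /min_p; lia.
have evp : ~~ odd p by rewrite -altp.
have p2 : p = 2 * p./2 by lia.
exists p./2; rewrite -p2; split=> //; last lia.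
rewrite lt0n; apply/negP=> /eqP p0; move: ap1; rewrite p2 p0.
by have [|->] := a_ends (i := 1); lia.
Qed.

(** Here [I] is the set of neighbours on the path of an outside vertex adjacent to
    its first vertex.  Split the positions into pairs [2q], [2q + 1].  The members of
    [A] at [2r] and [2r + 1] exclude both positions of the [j] pairs with
    [r < q <= r + j]; each of the [k] other pairs contains at most one point of
    [I], since such a point is in [A] and is not preceded by a member of [A]. *)
Lemma few_detours (I : nat -> bool) :
  (forall i, i < 2 * (k + j) -> I i -> a i) ->
  (forall i s, i < 2 * (k + j) -> s <= j -> 2 * s < i -> I i -> ~~ a (i.-1 - 2 * s)) ->
  \sum_(0 <= i < 2 * (k + j)) I i <= k.
Proof.
move=> Ia Iback; have [r [r_gt0 rk ar1 alt]] := first_double.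
have ar : a (2 * r) by rewrite alt //; lia.
apply: leq_trans (sum_pairs (h := fun q => (q <= r) || (r + j < q)) _) _; last first.
  by rewrite sum_outside; lia.
move=> q qm.
have I2 : I (2 * q) = false \/ I (2 * q).+1 = false.
  case I1 : (I (2 * q).+1); [left|by right].
  have := Iback (2 * q).+1 0; rewrite I1 subn0 /= => nq.
  by apply/negP => /Ia; lia.
have [qr|rq] := leqP q r; first by case: I2 => ->; case: (I _).
have [rjq|qrj] := ltnP; first by case: I2 => ->; case: (I _).
suff [-> ->] : I (2 * q) = false /\ I (2 * q).+1 = false by [].
split; apply/negP=> Iq.
- have := Iback (2 * q) (q - r.+1); rewrite Iq.
  have -> : (2 * q).-1 - 2 * (q - r.+1) = (2 * r).+1 by lia.
  by rewrite ar1; lia.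
- have := Iback (2 * q).+1 (q - r); rewrite Iq.
  have -> : (2 * q).+1.-1 - 2 * (q - r) = 2 * r by lia.
  by rewrite ar; lia.
Qed.

(** Here [N] is the set of neighbours of the first vertex on the path.  With the same
    pairs as for detours, [j] pairs are excluded and each of the others contributes
    weight at most 2, for if both its positions were in [N] then the two consecutive
    positions just before it would be outside [A]; the first pair contributes at most
    1, since position 0 is not in [N] and position 1 is not in [A]. *)
Lemma light_chords (N : nat -> bool) :
  ~~ N 0 ->
  (forall i s, i < 2 * (k + j) -> 0 < s <= j -> 2 * s <= i -> N i -> ~~ a (i - 2 * s)) ->
  \sum_(0 <= i < 2 * (k + j)) N i * (a i).+1 < 2 * k.
Proof.
move=> N0 Nback; have [r [r_gt0 rk ar1 alt]] := first_double.
have ar : a (2 * r) by rewrite alt //; lia.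
have sum0 : \sum_(0 <= i < 2 * (k + j)) (i == 0) = 1.
  rewrite big_ltn ?big_nat; last by lia.
  by rewrite big1 // => i; case: i.
(* The indicator of position 0 takes up the slack of the first pair. *)
suff : \sum_(0 <= i < 2 * (k + j)) (N i * (a i).+1 + (i == 0)) <= 2 * k.
  by rewrite big_split /= sum0; lia.
apply: leq_trans (sum_pairs (h := fun q => 2 * ((q <= r) || (r + j < q))) _) _; last first.
  by rewrite -(big_distrr 2) /= sum_outside; lia.
move=> q qm.
have [->|q_gt0] := posnP q.
  by rewrite muln0 (negPf N0) (alt 1) ?muln_gt0 //; case: (N 1).
have -> : (2 * q == 0) = false by lia.
rewrite /= !addn0.
have Nb i : i < 2 * (k + j) -> 2 <= i -> N i -> ~~ a (i - 2).
  by move=> im i2; apply: (Nback i 1).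
have bnd b c : (b : bool) * (c : bool).+1 <= 2 by case: b c => [] [].
have N2 : N (2 * q) = false \/ N (2 * q).+1 = false.
  case N1 : (N (2 * q).+1); [left|by right].
  have := Nb (2 * q).+1; rewrite N1 => n1.
  apply/negP => /Nb n2; have := a_adj (i := 2 * q - 2).
  have e : (2 * q).+1 - 2 = (2 * q - 2).+1 by lia.
  by rewrite e in n1; lia.
have pair : N (2 * q) * (a (2 * q)).+1 + N (2 * q).+1 * (a (2 * q).+1).+1 <= 2.
  by case: N2 => ->; rewrite mul0n ?addn0 ?add0n bnd.
have [qr|rq] := leqP q r; first exact: pair.
have [rjq|qrj] := ltnP; first exact: pair.
suff [-> ->] : N (2 * q) = false /\ N (2 * q).+1 = false by [].
split; apply/negP=> Nq.
- have := Nback (2 * q) (q - r); rewrite Nq.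
  have -> : 2 * q - 2 * (q - r) = 2 * r by lia.
  by rewrite ar; lia.
- have := Nback (2 * q).+1 (q - r); rewrite Nq.
  have -> : (2 * q).+1 - 2 * (q - r) = (2 * r).+1 by lia.
  by rewrite ar1; lia.
Qed.

End PositionCounting.

(** * Paths of order exactly [2k + 1] *)

Section CriticalExact.

Variables (V : finType) (g : rel V) (A : {set V}) (k t : nat).
Hypothesis crit : critical g A k t.

Local Notation g_sym := (crit_sym crit).
Local Notation g_irr := (crit_irr crit).
Local Notation g_A := (crit_edge crit).

(** A detour of the first vertex back to position [i], started at position
    [i - 1 - 2s] and stopped at position [2k + 2s - 1], visits [2k + 1] vertices, and
    so does a chord to position [i] started at position [i - 2s].  If no A-path has
    this order, then the starting positions are outside [A], as the two position
    counts require. *)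
Lemma apath_exact x p :
  0 < k -> t.+1 = 2 * k -> longest g A (x :: p) -> apath g A (x :: p) ->
  2 * k + 2 <= (size p).+1 -> exists2 s, apath g A s & size s = 2 * k + 1.
Proof.
move=> k_gt0 tk maxp xp km.
have [/existsP[s sP]|] := boolP [exists s : (2 * k + 1).-tuple V, apath g A s].
  by exists s; rewrite ?size_tuple.
rewrite negb_exists => /forallP none; exfalso.
have {}none s : apath g A s -> size s <> 2 * k + 1.
  by move=> sP szs; have := none (tcast szs (in_tuple s)); rewrite val_tcast sP.
have /and4P[px up xA lA] := xp.
pose a i := nth x (x :: p) i \in A.
have [||i|i|j [j_gt0 mE ends]] := @alternating_ends a k (size p).+1 km.
- by [].
- by rewrite /a -last_nth.
- exact: (nth_adj g_A px).
- move=> im; apply/negP=> /andP[iA jA].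
  have [||s sP szs] := apath_sub px up _ _ iA jA; try lia_nat.
  by apply: (none s sP); lia_nat.
have adj i : i.+1 < 2 * (k + j) -> a i || a i.+1 by rewrite -mE; exact: (nth_adj g_A px).
have ends_hi i : 2 * k <= i -> i < 2 * (k + j) -> a i = odd i.
  move=> ki im; have [|_] := ends (i - 2 * k); first by lia_nat.
  by rewrite subnKC // => ->; rewrite oddB // mul2n odd_double addbF.
have a2k1 : a (2 * k).-1.
  have := adj (2 * k).-1; rewrite prednK ?(ends_hi (2 * k)) ?muln_gt0 //; lia_nat.
(* These are the far ends of the rerouted paths. *)
have far s : s <= j -> a (2 * k + 2 * s).-1.
  case: s => [|s] sj; first by rewrite muln0 addn0.
  by rewrite ends_hi; lia_nat.
have xN z : g x z -> z \in x :: p.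
  move=> gxz; apply/negPn/negP=> zp.
  have [zA zN] := head_off g_sym g_irr g_A maxp xp gxz zp.
  have := crit_B crit zA (_ : g z x); rewrite g_sym => /(_ gxz).
  rewrite (sum_nbrs _ up zN) mE ltnNge => /negP; apply.
  under eq_bigr do rewrite muln1.
  apply: (few_detours k_gt0 j_gt0 adj ends (I := fun i => g z (nth x (x :: p) i))).
    by move=> i im /g_A; rewrite (negPf zA).
  move=> i s im sj si gzi; apply/negP=> lA'.
  have iA : a i by have := g_A gzi; rewrite (negPf zA).
  (* When the return point lies beyond the far end, both it and the starting
     position are in the alternating final part. *)
  have [iy|yi] := leqP i (2 * k + 2 * s).-1; last first.
    have oi : odd i by rewrite -ends_hi //; lia_nat.
    have [h iE] : exists h, i = (2 * h).+1 by exists i./2; lia_nat.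
    have e : i.-1 - 2 * s = 2 * (h - s) by rewrite iE /= mulnBr.
    by move: lA'; rewrite e ends_hi ?mul2n ?odd_double; lia_nat.
  have [||||||||q qP szq] :=
    @apath_splice _ _ A g_sym x p [:: z] (i.-1 - 2 * s) i (2 * k + 2 * s).-1 px up => //.
  - by lia_nat.
  - by lia_nat.
  - by case: i gzi si {iA im iy lA'} => [|i] //= gzi _; rewrite gxz gzi.
  - by move=> y; rewrite inE => /eqP ->.
  - by apply: far.
  by apply: (none q qP); rewrite szq /=; lia_nat.
have := crit_A crit xA; rewrite (sum_nbrs _ up xN) mE.
have := light_chords k_gt0 j_gt0 adj ends (N := fun i => g x (nth x (x :: p) i)).
rewrite -tk ltnS leqNgt => h1 h2; move: h2; apply/negP; apply: h1; first by rewrite /= g_irr.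
move=> i s im /andP[s_gt0 sj] si gxi; apply/negP=> lA'.
have gxi' : g x (nth x p i.-1) by case: i gxi {im si lA'} => [|i]; rewrite ?g_irr.
have [iy|yi] := leqP i (2 * k + 2 * s).-1.
  have [||||||||q qP szq] :=
    @apath_splice _ _ A g_sym x p [::] (i - 2 * s) i (2 * k + 2 * s).-1 px up => //.
  - by lia_nat.
  - by lia_nat.
  - by rewrite /= gxi'.
  - exact: far.
  by apply: (none q qP); rewrite szq /=; lia_nat.
(* The chord returns beyond the far end, to a vertex of [A]: starting at position
   [2k - 1] and stopping at [i] itself also gives order [2k + 1]. *)
have iA : a i.
  move: lA'; rewrite !ends_hi ?oddB ?mul2n ?odd_double ?addbF //; lia_nat.
have [||||||||q qP szq] :=
    @apath_splice _ _ A g_sym x p [::] (2 * k).-1 i i px up => //.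
- by lia_nat.
- by lia_nat.
- by rewrite /= gxi'.
by apply: (none q qP); rewrite szq /=; lia_nat.
Qed.

End CriticalExact.

(** * Passing to a critical subgraph *)

Section Reduction.

Variables (V : finType) (e : rel V) (A : {set V}).
Hypotheses (e_sym : symmetric e) (e_irr : irreflexive e).

(** The subgraph induced by [U], without the edges that avoid [A]. *)
Definition touching (U : {set V}) : rel V :=
  fun x y => [&& e x y, x \in U, y \in U & (x \in A) || (y \in A)].

Definition degree_sum (U : {set V}) := \sum_(x in A :&: U) \sum_(y in U) e x y.

Definition dense k t (U : {set V}) :=
  t * #|A :&: U| + k * #|U :\: A| < degree_sum U.

Lemma degree_sum_split (U X : {set V}) : X \subset U ->
  degree_sum U = degree_sum (U :\: X) + \sum_(y in X) \sum_(x in A :&: (U :\: X)) e x y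
                 + \sum_(x in A :&: X) \sum_(y in U) e x y.
Proof.
move=> XU; have UX : U :&: X = X by apply/setIidPr.
rewrite /degree_sum (big_setID X) /= -setIA UX addnC -setIDA; congr (_ + _).
rewrite [X in _ = _ + X]exchange_big -big_split /=; apply: eq_bigr => x _.
by rewrite (big_setID X) /= UX addnC.
Qed.

(** By minimality [U :\: X] is not dense, so removing [X] lowers the degree sum by
    more than the share of [X]. *)
Lemma minset_dense_cost k t (U X : {set V}) :
  minset (dense k t) U -> X \subset U -> X != set0 ->
  t * #|A :&: X| + k * #|X :\: A| <
  \sum_(y in X) \sum_(x in A :&: (U :\: X)) e x y
  + \sum_(x in A :&: X) \sum_(y in U) e x y.
Proof.
case/minsetP=> dU minU XU /set0Pn[x xX].
have ndUX : ~~ dense k t (U :\: X).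
  apply/negP=> /minU/(_ (subsetDl _ _)) E.
  by have := subsetP XU x xX; rewrite -E inE xX.
move: dU ndUX; rewrite /dense (degree_sum_split XU) -leqNgt.
have UX : U :&: X = X by apply/setIidPr.
have -> : #|A :&: U| = #|A :&: X| + #|A :&: (U :\: X)|.
  by rewrite -(cardsID X (A :&: U)) -setIA UX -setIDA.
have -> : #|U :\: A| = #|X :\: A| + #|(U :\: X) :\: A|.
  rewrite -(cardsID X (U :\: A)) setIDAC UX; congr (_ + #|pred_of_set _|).
  by rewrite !setDDl setUC.
lia.
Qed.

(** The three degree conditions come from removing a vertex of [A], a vertex outside
    [A], and a union of components: if the latter had at most [t + 1] vertices, then
    its vertices in [A] would have degree at most [t]. *)
Lemma minset_dense_critical k t (U : {set V}) :
  minset (dense k t) U -> critical (touching U) (A :&: U) k t.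
Proof.
move=> minU; have cost := minset_dense_cost minU.
have gUA x y : x \in A :&: U -> touching U x y = (y \in U) && e x y.
  by rewrite inE /touching => /andP[-> ->]; rewrite andbT andbC.
have gsym : symmetric (touching U).
  by move=> x y; rewrite /touching e_sym andbCA orbC; do !bool_congr.
split=> //.
- by move=> x; rewrite /touching e_irr.
- by move=> x y /and4P[_ xU yU]; rewrite !inE xU yU !andbT.
- move=> a aAU; have /setIP[aA aU] := aAU.
  have {cost} := cost [set a]; rewrite sub1set => /(_ aU).
  have -> : [set a] != set0 by apply/set0Pn; exists a; rewrite inE.
  have -> : A :&: [set a] = [set a] by apply/setIidPr; rewrite sub1set.
  rewrite cards1 muln1 !big_set1 => /(_ isT) cost.
  apply: leq_ltn_trans (leq_addr _ _) (leq_trans cost _).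
  rewrite big_mkcond /= [X in _ + X]big_mkcond -big_split /= [leqRHS]big_mkcond.
  apply: leq_sum => y _; rewrite gUA // !inE [e y a]e_sym.
  by case: (e a y); case: (y \in U); case: (y \in A); rewrite ?andbF //=; case: (_ != _).
- move=> b y bAU /and4P[_ bU yU]; move: bAU; rewrite inE bU andbT => bA _.
  have {cost} := cost [set b]; rewrite sub1set => /(_ bU).
  have -> : [set b] != set0 by apply/set0Pn; exists b; rewrite inE.
  have -> : A :&: [set b] = set0.
    by apply/setP=> z; rewrite !inE andbC; case: eqP => // ->; rewrite (negPf bA).
  have -> : [set b] :\: A = [set b] by apply/setDidPl; rewrite disjoints1.
  rewrite cards1 cards0 muln0 muln1 big_set1 big_set0 addn0 => /(_ isT) cost.
  apply: leq_trans cost _; rewrite big_mkcond [leqRHS]big_mkcond.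
  apply: leq_sum => z _; rewrite gsym !inE /touching bU.
  by case: (e z b); case: (z \in U); case: (z \in A); rewrite ?andbF //=; case: (_ != _).
- move=> X a closedX aX /setIP[aA aU]; rewrite ltnNge; apply/negP=> Xt.
  have := cost (X :&: U) (subsetIr _ _).
  have -> : X :&: U != set0 by apply/set0Pn; exists a; rewrite inE aX.
  rewrite [X in _ < X + _]big1 => [|y /setIP[yX yU]]; last first.
    apply: big1 => x; rewrite !inE negb_and => /and3P[xA + xU]; rewrite xU orbF => xX.
    apply/eqP; rewrite eqb0; apply: contra xX => exy.
    by apply: (closedX y) => //; rewrite gsym gUA ?inE ?xA ?xU // yU.
  move=> /(_ isT); rewrite add0n ltnNge => /negP; apply.
  apply: leq_trans (leq_addr _ _).
  rewrite mulnC -sum_nat_const; apply: leq_sum => x /setIP[xA /setIP[xX xU]].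
  have /(leq_trans _)-> // : #|X :\ x| <= t by move: Xt; rewrite (cardsD1 x) xX.
  rewrite -sum1_card big_mkcond [leqRHS]big_mkcond; apply: leq_sum => y _ /=.
  case: ifP => // yU; case exy: (e x y) => //.
  rewrite !inE (closedX x) ?gUA ?inE ?xA ?yU //.
  by case: eqP exy => // ->; rewrite e_irr.
Qed.

Lemma touching_apath (U : {set V}) s :
  apath (touching U) (A :&: U) s -> has_path_with_ends_in e A (size s).
Proof.
case: s => // x p /and4P[xp up /setIP[xA _] /setIP[lA _]].
by exists x, p; split=> //; apply: sub_path xp => y z /and4P[].
Qed.

(** Each edge inside [A] is counted at both its ends. *)
Lemma edges_in_bound : 2 * edges_in e A <= \sum_(x in A) \sum_(y in A) e x y.
Proof.
rewrite mulnC -sum_nat_const.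
have cardE E : E \in [set E in edges e | E \subset A] -> 2 = \sum_(x in A) (x \in E).
  rewrite !inE => /andP[/existsP[x /existsP[y /andP[exy /eqP->]]] sub].
  have -> : 2 = #|[set x; y]| by rewrite cards2; case: eqP exy => // ->; rewrite e_irr.
  rewrite -sum1_card big_mkcond [RHS]big_mkcond; apply: eq_bigr => z _ /=.
  by case: ifP => [/(subsetP sub)->|_]; last case: ifP.
rewrite (eq_bigr _ cardE) exchange_big /=; apply: leq_sum => x xA.
have -> : \sum_(y in A) e x y = #|[set y in A | e x y]|.
  rewrite -sum1_card big_mkcond [RHS]big_mkcond; apply: eq_bigr => y _.
  by rewrite inE; case: (y \in A); case: (e x y).
apply: leq_trans (leq_imset_card (fun y => [set x; y]) _).
have -> : \sum_(E in [set E in edges e | E \subset A]) (x \in E) =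
          #|[set E in edges e | (E \subset A) && (x \in E)]|.
  rewrite -sum1_card big_mkcond [RHS]big_mkcond; apply: eq_bigr => E _; rewrite !inE.
  by rewrite andbA; case: (_ && (E \subset A)); case: (x \in E).
apply/subset_leq_card/subsetP=> E.
rewrite !inE => /and3P[/existsP[u /existsP[v /andP[euv /eqP->]]] sub].
rewrite !inE => /orP[] /eqP xE; subst x.
  apply/imsetP; exists v; rewrite // inE euv andbT.
  by apply: (subsetP sub); rewrite !inE eqxx orbT.
apply/imsetP; exists u; last by rewrite setUC.
by rewrite inE e_sym euv andbT; apply: (subsetP sub); rewrite !inE eqxx.
Qed.

Lemma edges_between_bound (B : {set V}) :
  edges_between e A B <= \sum_(x in A) \sum_(y in B) e x y.
Proof.
pose S := [set u : V * V | [&& u.1 \in A, u.2 \in B & e u.1 u.2]].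
have -> : \sum_(x in A) \sum_(y in B) e x y = #|S|.
  rewrite pair_big -sum1_card big_mkcond [RHS]big_mkcond /=; apply: eq_bigr => -[x y] _.
  by rewrite inE /=; case: (x \in A); case: (y \in B); case: (e x y).
apply: leq_trans (leq_imset_card (fun u => [set u.1; u.2]) _).
apply/subset_leq_card/subsetP=> E; rewrite inE.
case/andP=> Ee /exists_inP[x xA /exists_inP[y yB /eqP EE]].
apply/imsetP; exists (x, y) => //; rewrite inE /= xA yB /=.
move: Ee; rewrite inE EE => /existsP[u /existsP[v /andP[euv /eqP Exy]]].
have [xy|xy] := eqVneq x y.
  move: euv; have : u \in [set x; y] by rewrite Exy !inE eqxx.
  have : v \in [set x; y] by rewrite Exy !inE eqxx orbT.
  by rewrite xy !inE !orbb => /eqP-> /eqP->; rewrite e_irr.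
have : x \in [set u; v] by rewrite -Exy !inE eqxx.
have : y \in [set u; v] by rewrite -Exy !inE eqxx orbT.
rewrite !inE => /orP[] /eqP yE /orP[] /eqP xE; subst x y => //; rewrite ?eqxx // in xy *.
by rewrite e_sym.
Qed.

Lemma critical_exists k t (B : {set V}) :
  A :|: B = [set: V] -> [disjoint A & B] ->
  t * #|A| + k * #|B| < 2 * edges_in e A + edges_between e A B ->
  exists U, critical (touching U) (A :&: U) k t /\ exists a, a \in A :&: U.
Proof.
move=> AB_cover AB_disj large.
have BE : B = ~: A.
  apply/setP=> x; have /setP/(_ x) := AB_cover; rewrite !inE.
  by case xA : (x \in A) => /=; [rewrite (disjointFr AB_disj xA) | move=> ->].
have dT : dense k t setT.
  rewrite /dense setIT setTD -BE; apply: leq_trans large _.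
  apply: leq_trans (leq_add edges_in_bound (edges_between_bound B)) _.
  rewrite /degree_sum setIT -big_split /=; apply: leq_sum => x _.
  by rewrite [leqRHS](big_setID A) setTI setTD -BE.
have [U minU _] := minset_exists dT.
exists U; split; first exact: minset_dense_critical.
apply/set0Pn; apply: contraL (minsetp minU) => /eqP AU.
by rewrite /dense /degree_sum AU big_set0.
Qed.

End Reduction.

Lemma critical_longest (V : finType) (g : rel V) (A : {set V}) k t a :
  critical g A k t -> a \in A -> t.+1 <= 2 * k -> 2 * k <= t.+2 ->
  exists x p, [/\ apath g A (x :: p), longest g A (x :: p) & t.+1 < size (x :: p)].
Proof.
move=> crit aA tk kt.
have a_path : apath g A [:: a] by rewrite /= aA.
have [[//|x p] xp maxp] := ex_longest (@apath_uniq _ g A) a_path.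
by exists x, p; split=> //; exact: (longest_apath_long crit).
Qed.

Theorem lemma1 (k : nat) (V : finType) (e : rel V) (A B : {set V})
    (hk : 1 <= k) (e_sym : symmetric e) (e_irr : irreflexive e)
    (AB_cover : A :|: B = [set: V]) (AB_disj : [disjoint A & B]) :
  ((2 * k - 2) * #|A| + k * #|B| < 2 * edges_in e A + edges_between e A B ->
     has_path_with_ends_in e A (2 * k) \/
     has_path_with_ends_in e A (2 * k + 1))
  /\
  ((2 * k - 1) * #|A| + k * #|B| < 2 * edges_in e A + edges_between e A B ->
     has_path_with_ends_in e A (2 * k + 1)).
Proof.
split=> large.
  have [U [crit [a aU]]] := critical_exists e_sym e_irr AB_cover AB_disj large.
  have [||x [p [xp _ szp]]] := critical_longest crit aU; try lia.
  have /and4P[px up xA lA] := xp.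
  have [|s sP szs] := apath_trunc (n := 2 * k) (crit_edge crit) px up xA lA.
    by move: szp => /=; lia.
  have := touching_apath sP.
  by case: szs => ->; [left | right; rewrite addn1].
have [U [crit [a aU]]] := critical_exists e_sym e_irr AB_cover AB_disj large.
have [||x [p [xp maxp szp]]] := critical_longest crit aU; try lia.
have [sz_eq|sz_ne] := eqVneq (size (x :: p)) (2 * k + 1).
  by rewrite -sz_eq; exact: touching_apath xp.
have [||s sP <-] := apath_exact crit hk _ maxp xp.
- by lia.
- by move: szp sz_ne => /=; lia.
exact: touching_apath sP.
Qed.
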